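(* Let $p:\mathbb{Z}^n\to\mathbb{C}$ and $M\in\mathbb{N}$. Then for $\xi,\theta\in\mathbb{Z}^n$ we can write $$p(\xi+\theta)=\sum_{|\alpha|<M}\frac{1}{\alpha!}\,\theta^{(\alpha)}\,\triangle_\xi^\alpha p(\xi)+r_M(\xi,\theta),$$ with remainder $r_M(\xi,\theta)$ satisfying, for all $\omega\in\mathbb{N}_0^n$ and all $\xi,\theta\in\mathbb{Z}^n$, $$\bigl|\triangle_\xi^\omega r_M(\xi,\theta)\bigr|\le C_M\max_{|\alpha|=M,\ \nu\in Q(\theta)}\Bigl|\theta^{(\alpha)}\,\triangle_\xi^{\alpha+\omega}p(\xi+\nu)\Bigr|,$$ where $Q(\theta):=\{\nu\in\mathbb{Z}^n:\ |\nu_j|\le|\theta_j|\text{ for all }j=1,\ldots,n\}$ and the constant $C_M$ depends only on $M$ and $n$.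
   Context: For $\sigma:\mathbb{Z}^n\to\mathbb{C}$: $\triangle_{\xi_j}\sigma(\xi)=\sigma(\xi+e_j)-\sigma(\xi)$ ($e_j$ the $j$-th standard unit vector) and $\triangle_\xi^\alpha=\triangle_{\xi_1}^{\alpha_1}\cdots\triangle_{\xi_n}^{\alpha_n}$ for $\alpha\in\mathbb{N}_0^n$. For $\theta\in\mathbb{Z}^n$, $\alpha\in\mathbb{N}_0^n$: $\theta^{(\alpha)}=\theta_1^{(\alpha_1)}\cdots\theta_n^{(\alpha_n)}$, where $\theta_j^{(0)}=1$ and $\theta_j^{(k+1)}=\theta_j(\theta_j-1)\cdots(\theta_j-k)$. $\alpha!=\alpha_1!\cdots\alpha_n!$ and $|\alpha|=\alpha_1+\cdots+\alpha_n$. *)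

(* Defs.v *)
From HB Require Import structures.
From mathcomp Require Import all_boot all_order all_algebra.
From mathcomp Require Import finmap complex mpoly.
From mathcomp Require Import classical_sets functions cardinality reals.

Set Implicit Arguments.
Unset Strict Implicit.
Unset Printing Implicit Defensive.

Import Order.TTheory GRing.Theory Num.Theory.
Local Open Scope ring_scope.

(* Points of Z^n are row vectors 'rV[int]_n; multi-indices in N_0^n are the
   monomials 'X_{1..n} of multinomials, with |alpha| = mdeg alpha. *)

Definition fdiff (n : nat) (V : zmodType) (j : 'I_n)
    (sigma : 'rV[int]_n -> V) : 'rV[int]_n -> V :=
  fun xi => sigma (xi + delta_mx 0 j) - sigma xi.

Definition mfdiff (n : nat) (V : zmodType) (alpha : 'X_{1..n})
    (sigma : 'rV[int]_n -> V) : 'rV[int]_n -> V :=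
  (\big[@comp _ _ _/id]_(j < n) iter (alpha j) (fdiff j)) sigma.

Definition falling (x : int) (k : nat) : int := \prod_(i < k) (x - i%:Z).

Definition mfalling (n : nat) (theta : 'rV[int]_n) (alpha : 'X_{1..n}) : int :=
  \prod_(j < n) falling (theta 0 j) (alpha j).

Definition mfactorial (n : nat) (alpha : 'X_{1..n}) : nat :=
  (\prod_(j < n) (alpha j)`!)%N.

Definition Qbox (n : nat) (theta : 'rV[int]_n) : set 'rV[int]_n :=
  [set nu | forall j : 'I_n, `|nu 0 j| <= `|theta 0 j|]%classic.

(* fset_set, used in max_taylor below, is the empty set on infinite sets. *)
Lemma finite_Qbox (n : nat) (theta : 'rV[int]_n) : finite_set (Qbox theta).
Proof.
pose N := (\max_(j < n) `|theta 0%R j|)%N.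
pose f (t : {ffun 'I_n -> 'I_(N + N).+1}) : 'rV[int]_n :=
  \row_j ((t j)%:Z - N%:Z).
apply: (@sub_finite_set _ _ (f @` setT)%classic); last first.
  by apply: finite_image; exact: finite_finset.
move=> nu /= nuQ.
have nuN j : `|nu 0 j| <= N%:Z.
  apply: le_trans (nuQ j) _; rewrite -abszE lez_nat.
  exact: (@leq_bigmax _ (fun j => `|theta 0%R j|%N)).
exists [ffun j => inord `|(nu 0%R j + N%:Z)%R|%N] => //.
apply/rowP => j; rewrite mxE ffunE.
have := nuN j; rewrite ler_norml => /andP[h1 h2].
have h0 : 0 <= nu 0 j + N%:Z by rewrite -lerBlDr sub0r.
rewrite inordK.
  by rewrite abszE ger0_norm // addrK.
by rewrite ltnS -lez_nat abszE ger0_norm // PoszD lerD2r.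
Qed.

Definition cabs (R : realType) (z : R[i]) : R := ComplexField.Normc.normc z.

(* The maximum over |alpha| = M and nu in Q(theta). The values are nonnegative
   and, for n >= 1, the index set is nonempty, so the default 0 is harmless.
   The type 'X_{1..n < M.+1} is the finite type of the alpha with
   |alpha| <= M. *)
Definition max_taylor (R : realType) (n M : nat) (p : 'rV[int]_n -> R[i])
    (omega : 'X_{1..n}) (xi theta : 'rV[int]_n) : R :=
  \big[Num.max/0]_(alpha : 'X_{1..n < M.+1} | mdeg alpha == M)
    \big[Num.max/0]_(nu <- fset_set (Qbox theta))
      cabs ((mfalling theta alpha)%:~R
            * mfdiff (alpha + omega)%MM p (xi + nu)).

(* Main.v *)
(* Write r_M[p](xi, theta) for the remainder. Differencing the Taylor sum in
   theta_j lowers the falling factorials, so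
     r_{M+1}[p](xi, theta + e_j) - r_{M+1}[p](xi, theta)
       = r_M[fdiff j p](xi, theta),      r_{M+1}[p](xi, 0) = 0.
   Summing these increments along a path from 0 to theta that moves through
   the coordinates one after the other gives the bound n^M by induction on M:
   the j-th leg has |theta_j| steps, and at each point eta of it
   |theta_j eta^(beta)| <= |theta^(beta + e_j)|. The operator mfdiff omega
   commutes with translations and linear combinations, so it turns the
   remainder of p into the remainder of mfdiff omega p. *)
Require Import Defs.
From mathcomp Require Import all_boot all_order all_algebra.
From mathcomp Require Import ring zify finmap complex mpoly.
From mathcomp Require Import boolp classical_sets functions cardinality reals.
Import Order.TTheory GRing.Theory Num.Theory.
Local Open Scope ring_scope.

Set Implicit Arguments.
Unset Strict Implicit.

(** * Operators commuting with translations and linear combinations *)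

(** These two properties pass to compositions, hence from [fdiff] to every [mfdiff alpha], and they
    suffice to commute an operator with [fdiff] and with finite Taylor sums. *)
Definition trans_linear {n : nat} {F : pzRingType}
    (L : ('rV[int]_n -> F) -> 'rV[int]_n -> F) : Prop :=
  (forall c f g, L (fun x => c * f x + g x) = fun x => c * L f x + L g x) /\
  (forall f t, L (fun x => f (x + t)) = fun x => L f (x + t)).

Lemma trans_linear_id n (F : pzRingType) :
  trans_linear (id : ('rV[int]_n -> F) -> _).
Proof. by []. Qed.

Lemma trans_linear_comp n (F : pzRingType)
    (K L : ('rV[int]_n -> F) -> 'rV[int]_n -> F) :
  trans_linear K -> trans_linear L -> trans_linear (K \o L).
Proof.
move=> [Kl Kt] [Ll Lt]; split=> [c f g|f t] /=; first by rewrite Ll Kl.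
by rewrite Lt Kt.
Qed.

Lemma trans_linear_iter n (F : pzRingType) k
    (L : ('rV[int]_n -> F) -> 'rV[int]_n -> F) :
  trans_linear L -> trans_linear (iter k L).
Proof.
move=> tL; elim: k => [|k IH]; first exact: trans_linear_id.
exact: (trans_linear_comp tL IH).
Qed.

Lemma trans_linear_fdiff n (F : pzRingType) (j : 'I_n) :
  trans_linear (@fdiff n F j).
Proof.
split=> [c f g|f t]; apply: funext => x; rewrite /fdiff.
  by rewrite mulrBr opprD addrACA.
by rewrite addrAC.
Qed.

Lemma trans_linear_mfdiff n (F : pzRingType) (alpha : 'X_{1..n}) :
  trans_linear (@mfdiff n F alpha).
Proof.
apply: (big_ind (@trans_linear n F)); first exact: trans_linear_id.
  exact: trans_linear_comp.
by move=> j _; apply/trans_linear_iter/trans_linear_fdiff.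
Qed.

Lemma trans_linearB n (F : pzRingType)
    (L : ('rV[int]_n -> F) -> 'rV[int]_n -> F) :
  trans_linear L -> forall f g,
  L (fun x => f x - g x) = fun x => L f x - L g x.
Proof.
move=> [Ll _] f g.
have -> : (fun x => f x - g x) = (fun x => -1 * g x + f x).
  by apply: funext => x; rewrite mulN1r addrC.
by rewrite Ll; apply: funext => x; rewrite mulN1r addrC.
Qed.

Lemma trans_linear_sum n (F : pzRingType)
    (L : ('rV[int]_n -> F) -> 'rV[int]_n -> F) (I : Type) (s : seq I)
    (c : I -> F) (f : I -> 'rV[int]_n -> F) :
  trans_linear L ->
  L (fun x => \sum_(i <- s) c i * f i x)
    = fun x => \sum_(i <- s) c i * L (f i) x.
Proof.
move=> [Ll Lt]; elim: s => [|i s IH].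
  have -> : (fun x => \sum_(i <- [::]) c i * f i x) = (fun=> 0 : F).
    by apply: funext => x; rewrite big_nil.
  apply: funext => x; rewrite big_nil.
  (* The zero function equals [-1 * 0 + 0], so [L 0 = - L 0 + L 0 = 0]. *)
  have := Ll (-1) (fun=> 0) (fun=> 0).
  rewrite (_ : (fun=> -1 * 0 + 0 : F) = (fun=> 0)); last first.
    by apply: funext => y; rewrite mulr0 addr0.
  by move/(congr1 (@^~ x)) => ->; rewrite mulN1r addNr.
have -> : (fun x => \sum_(k <- i :: s) c k * f k x)
    = (fun x => c i * f i x + \sum_(k <- s) c k * f k x).
  by apply: funext => x; rewrite big_cons.
by rewrite Ll IH; apply: funext => x; rewrite big_cons.
Qed.

Lemma trans_linear_fdiffC n (F : pzRingType) (j : 'I_n)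
    (L : ('rV[int]_n -> F) -> 'rV[int]_n -> F) :
  trans_linear L -> L \o fdiff j = fdiff j \o L.
Proof.
move=> tL; apply: funext => f /=; rewrite /fdiff.
by rewrite trans_linearB //; case: tL => _ ->.
Qed.

Lemma iter_fdiffC n (F : pzRingType) (j : 'I_n) k
    (L : ('rV[int]_n -> F) -> 'rV[int]_n -> F) :
  trans_linear L -> L \o iter k (fdiff j) = iter k (fdiff j) \o L.
Proof.
move=> tL; apply: funext => f /=; elim: k => //= k IH.
by have /= -> := congr1 (@^~ (iter k (fdiff j) f)) (trans_linear_fdiffC j tL);
  rewrite IH.
Qed.

(** [mfdiff] composes the coordinates in a fixed order. Peeling off one coordinate [j] at a time,
    the powers of [fdiff j] coming from [b] are moved past the differences from [a] in the remaining
    coordinates. *)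
Lemma mfdiffD n (F : pzRingType) (a b : 'X_{1..n}) (f : 'rV[int]_n -> F) :
  mfdiff (a + b)%MM f = mfdiff a (mfdiff b f).
Proof.
rewrite /mfdiff; elim: (index_enum _) f => [|j s IH] f; first by rewrite !big_nil.
rewrite !big_cons /= IH mnmDE iterD.
congr (iter _ _ _).
have tL : trans_linear (\big[comp/id]_(i <- s) iter (a i) (@fdiff n F i)).
  apply: big_ind; [exact: trans_linear_id | exact: trans_linear_comp |].
  by move=> i _; apply/trans_linear_iter/trans_linear_fdiff.
set g := (X in _ = _ (iter _ _ X)).
by have /= <- := congr1 (@^~ g) (iter_fdiffC j (b j) tL).
Qed.

Lemma mfdiff0 n (V : zmodType) (f : 'rV[int]_n -> V) : mfdiff 0%MM f = f.
Proof.
rewrite /mfdiff; elim: (index_enum _) => [|j s IH]; first by rewrite big_nil.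
by rewrite big_cons /= mnm0E IH.
Qed.

Lemma mfdiffU n (V : zmodType) (j : 'I_n) (f : 'rV[int]_n -> V) :
  mfdiff U_(j)%MM f = fdiff j f.
Proof.
rewrite /mfdiff.
have : forall s, uniq s ->
    (\big[comp/id]_(i <- s) iter (U_(j)%MM i) (@fdiff n V i)) f
    = if j \in s then fdiff j f else f.
  elim=> [|i s IH] /=; first by rewrite big_nil.
  case/andP => /negPf js /IH {}IH; rewrite big_cons /= IH mnm1E inE.
  by case: eqP => [->|_] //=; rewrite js.
by move=> -> //; [rewrite mem_index_enum | exact: index_enum_uniq].
Qed.

(** * Falling factorials in one variable *)

Lemma fallingS x k : falling x k.+1 = falling x k * (x - k%:Z).
Proof. by rewrite /falling big_ord_recr. Qed.

Lemma falling_succ x k : falling (x + 1) k.+1 = (x + 1) * falling x k.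
Proof.
rewrite /falling big_ord_recl subr0; congr (_ * _); apply: eq_bigr => i _.
by rewrite lift0; lia.
Qed.

Lemma falling_diff x k :
  falling (x + 1) k.+1 - falling x k.+1 = k.+1%:Z * falling x k.
Proof. by rewrite falling_succ fallingS; ring. Qed.

(** After cancelling the common factor [t], the factors compare one by one:
    [|s - i| <= |t - (i + 1)|]. This can fail only for [0 <= s < k], where [falling s k]
    vanishes. *)
Lemma falling_bound (s t : int) k :
  0 <= s < t \/ t <= s < 0 -> `|t * falling s k| <= `|falling t k.+1|.
Proof.
rewrite normrM /falling !normr_prod; case=> st.
- have [sk|ks] := ltP s k%:Z.
    have [m em] : exists m : nat, s = m by exists `|s|%N; lia.
    have mk : (m < k)%N by lia.
    rewrite (bigD1 (Ordinal mk)) //= em subrr normr0 mul0r mulr0.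
    by rewrite prodr_ge0.
  rewrite big_ord_recl subr0 ler_pM2l; last by lia.
  by apply: ler_prod => i _; rewrite lift0; have := ltn_ord i; lia.
- rewrite big_ord_recl subr0 ler_pM2l; last by lia.
  by apply: ler_prod => i _; rewrite lift0; have := ltn_ord i; lia.
Qed.

(** For the coordinates that the path from 0 to theta has not yet moved: the left side is 0 unless
    [k = 0], when both sides are 1. *)
Lemma falling0_bound (t : int) k : `|falling 0 k| <= `|falling t k|.
Proof.
case: k => [|k]; first by rewrite /falling !big_ord0.
by rewrite [falling 0 _]/falling big_ord_recl subr0 mul0r normr0.
Qed.

(** * Taylor coefficients and their differences in theta *)

Definition taylor_coef {F : numFieldType} {n : nat} (theta : 'rV[int]_n)
    (alpha : 'X_{1..n}) : F :=
  (mfactorial alpha)%:R^-1 * (mfalling theta alpha)%:~R.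

Lemma taylor_coef0 (F : numFieldType) n (alpha : 'X_{1..n}) :
  taylor_coef 0 alpha = (alpha == 0%MM)%:R :> F.
Proof.
rewrite /taylor_coef /mfalling /mfactorial; have [->|a0] := eqVneq.
  rewrite !big1 ?invr1 ?mul1r // => i _; rewrite mnm0E //.
  by rewrite /falling big_ord0.
have [j aj] : exists j, alpha j != 0%N.
  apply/existsP; apply: contraNT a0 => /existsPn a0.
  by apply/eqP/mnmP => j; rewrite mnm0E; apply/eqP; have := a0 j; rewrite negbK.
rewrite (bigD1 j) //= [\prod_(i < n) falling _ _](bigD1 j) //= mxE.
case: (alpha j) aj => // k _.
by rewrite [falling 0 _]/falling big_ord_recl subr0 !mul0r mulr0.
Qed.

Lemma taylor_coef_diff_eq0 (F : numFieldType) n (theta : 'rV[int]_n)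
    (alpha : 'X_{1..n}) (j : 'I_n) : alpha j = 0%N ->
  taylor_coef (theta + delta_mx 0 j) alpha = taylor_coef theta alpha :> F.
Proof.
move=> aj; congr (_ * _%:~R); apply: eq_bigr => i _; rewrite !mxE eqxx.
by have [->|_] := eqVneq i j; rewrite ?aj /= ?addr0 // /falling !big_ord0.
Qed.

(** Differencing the falling factorial in coordinate [j] produces the factor [(beta j).+1], which
    cancels the extra factor in the factorial of [beta + U_(j)]. *)
Lemma taylor_coef_diff (F : numFieldType) n (theta : 'rV[int]_n)
    (beta : 'X_{1..n}) (j : 'I_n) :
  taylor_coef (theta + delta_mx 0 j) (beta + U_(j))%MM
    - taylor_coef theta (beta + U_(j))%MM = taylor_coef theta beta :> F.
Proof.
rewrite /taylor_coef -mulrBr -rmorphB.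
have ne i : i != j -> (beta + U_(j))%MM i = beta i.
  by move=> ij; rewrite mnmDE mnm1E eq_sym (negPf ij) addn0.
have ej : (beta + U_(j))%MM j = (beta j).+1 by rewrite mnmDE mnm1E eqxx addn1.
have -> : mfactorial (beta + U_(j))%MM = ((beta j).+1 * mfactorial beta)%N.
  rewrite /mfactorial (bigD1 j) //= [in RHS](bigD1 j) //= ej factS mulnA.
  by congr (_ * _)%N; apply: eq_bigr => i /ne ->.
have -> : mfalling (theta + delta_mx 0 j) (beta + U_(j))%MM
    - mfalling theta (beta + U_(j))%MM = (beta j).+1%:Z * mfalling theta beta.
  rewrite /mfalling (bigD1 j) //= [X in _ - X](bigD1 j) //=.
  rewrite [in RHS](bigD1 j) //= ej mulrA -falling_diff mulrBl.
  congr (_ * _ - _ * _).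
  - by rewrite !mxE !eqxx.
  - apply: eq_bigr => i /[dup] /ne -> ij.
    by rewrite !mxE eqxx /= (negPf ij) addr0.
  - by apply: eq_bigr => i /ne ->.
rewrite natrM invfM rmorphM /= mulrCA !mulrA -pmulrn.
by rewrite mulfV ?mul1r // pnatr_eq0.
Qed.

(** Adding [U_(j)] is a bijection from the multi-indices of degree below [M] onto those of degree
    below [M.+1] with nonzero [j]-th entry. *)
Lemma sum_mnm_addU (V : nmodType) n M (j : 'I_n) (G : 'X_{1..n} -> V) :
  \sum_(a : 'X_{1..n < M.+1} | a j != 0%N) G a
    = \sum_(b : 'X_{1..n < M}) G (b + U_(j))%MM.
Proof.
have lt (b : 'X_{1..n < M}) : (mdeg (b + U_(j))%MM < M.+1)%N.
  by rewrite mdegD mdeg1 addn1 ltnS bmdeg.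
pose h b : 'X_{1..n < M.+1} := BMultinom (lt b).
(* For [M = 0] both sums are empty. Otherwise the zero multi-index serves as default value of the
   inverse map [h']; the default is never taken when [a j != 0]. *)
have [M0|M0] := posnP M.
  rewrite !big_pred0 //.
    by move=> b; have := bmdeg b; rewrite {2}M0.
  move=> a; apply/negbTE; rewrite negbK; have := bmdeg a.
  rewrite {2}M0 ltnS leqn0 mdeg_eq0 => /eqP ->; by rewrite mnm0E.
have lt0 : (mdeg (0%MM : 'X_{1..n}) < M)%N by rewrite mdeg0.
pose h' (a : 'X_{1..n < M.+1}) : 'X_{1..n < M} :=
  insubd (BMultinom lt0) (a - U_(j))%MM.
have vh' (a : 'X_{1..n < M.+1}) : a j != 0%N -> h' a = (a - U_(j))%MM :> 'X_{1..n}.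
  move=> aj; rewrite [LHS]insubdK // unfold_in -ltnS /=.
  have := bmdeg a; rewrite -{1}(submK (m := U_(j)%MM) (m' := a)) ?lep1mP //.
  by rewrite mdegD mdeg1 addn1.
rewrite (reindex_onto h h'); last first.
  by move=> a aj; apply: val_inj; rewrite /= vh' // submK // lep1mP.
apply: eq_bigl => b.
have hj : (h b) j != 0%N by rewrite mnmDE mnm1E eqxx addn1.
by rewrite hj -val_eqE /= vh' //= addmK eqxx.
Qed.

(** * The remainder and its difference equation *)

Definition taylor_rem {F : numFieldType} {n : nat} (M : nat)
    (p : 'rV[int]_n -> F) (xi theta : 'rV[int]_n) : F :=
  p (xi + theta)
    - \sum_(alpha : 'X_{1..n < M}) taylor_coef theta alpha * mfdiff alpha p xi.

Lemma mfdiff_taylor_rem (F : numFieldType) n M (omega : 'X_{1..n})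
    (p : 'rV[int]_n -> F) (theta xi : 'rV[int]_n) :
  mfdiff omega (fun x => taylor_rem M p x theta) xi
    = taylor_rem M (mfdiff omega p) xi theta.
Proof.
have tL := trans_linear_mfdiff F omega.
rewrite trans_linearB // trans_linear_sum // /taylor_rem.
congr (_ - _); first by case: tL => _ ->.
by apply: eq_bigr => a _; rewrite -!mfdiffD addmC.
Qed.

Lemma taylor_rem_diff (F : numFieldType) n M (p : 'rV[int]_n -> F)
    (xi theta : 'rV[int]_n) (j : 'I_n) :
  taylor_rem M.+1 p xi (theta + delta_mx 0 j) - taylor_rem M.+1 p xi theta
    = taylor_rem M (fdiff j p) xi theta.
Proof.
rewrite /taylor_rem {1}/fdiff addrA (addrAC xi theta).
set S1 := \sum_(i : _) _; set S0 := \sum_(i : _) _; set S := \sum_(i : _) _.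
suff <- : S1 - S0 = S by ring.
rewrite /S1 /S0 /S -sumrB.
(* Terms with [a j = 0] do not change along [e_j] and cancel; the others are reindexed as
   [b + U_(j)]. *)
rewrite (bigID (fun a : 'X_{1..n < M.+1} => a j != 0%N)) /=.
rewrite [X in _ + X]big1 ?addr0; last first.
  move=> a /negPn/eqP aj; by rewrite taylor_coef_diff_eq0 // subrr.
rewrite (sum_mnm_addU _ j (fun a => taylor_coef (theta + delta_mx 0 j) a
  * mfdiff a p xi - taylor_coef theta a * mfdiff a p xi)).
apply: eq_bigr => b _.
by rewrite -mulrBl taylor_coef_diff mfdiffD mfdiffU.
Qed.

Lemma taylor_rem0 (F : numFieldType) n M (p : 'rV[int]_n -> F)
    (xi : 'rV[int]_n) : taylor_rem M.+1 p xi 0 = 0.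
Proof.
have lt0 : (mdeg (0%MM : 'X_{1..n}) < M.+1)%N by rewrite mdeg0.
rewrite /taylor_rem (bigD1 (BMultinom lt0)) //= big1 ?addr0; last first.
  move=> a; rewrite -val_eqE /= => /negPf a0.
  by rewrite taylor_coef0 a0 mul0r.
by rewrite taylor_coef0 eqxx mul1r mfdiff0 subrr.
Qed.

(** * Estimate along a coordinate path *)

(** The admissible [s] are the left endpoints of the unit steps between 0 and [t]: from 0 to [t - 1]
    if [t > 0], from [t] to -1 if [t < 0]. *)
Lemma telescope_int (F : numFieldType) (f : int -> F) (K : F) (t : int) :
  (forall s, 0 <= s < t \/ t <= s < 0 -> `|f (s + 1) - f s| <= K) ->
  `|f t - f 0| <= `|t|%:~R * K.
Proof.
case: (intP t) => [|m|m] H; first by rewrite subrr !normr0 mul0r.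
- rewrite (_ : `|m.+1%:Z| = m.+1%:Z) //; move: H; elim: m.+1 => {m} [|m IH] H.
    by rewrite subrr normr0 mul0r.
  rewrite -[X in X - _](subrK (f m%:Z)) -addrA.
  apply: le_trans (ler_normD _ _) _.
  rewrite -addn1 PoszD intrD mulrDl mul1r [leRHS]addrC lerD //; first by apply: H; lia.
  by apply: IH => s hs; apply: H; lia.
- rewrite (_ : `|- m.+1%:Z| = m.+1%:Z) //; move: H; elim: m.+1 => {m} [|m IH] H.
    by rewrite oppr0 subrr normr0 mul0r.
  rewrite -[X in X - _](subrK (f (- m%:Z))) -addrA.
  apply: le_trans (ler_normD _ _) _.
  rewrite -addn1 PoszD intrD mulrDl mul1r [leRHS]addrC lerD //.
    (* The last step runs downwards, so its difference is reversed to start at the left endpoint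
       [-(m + 1)]. *)
    rewrite distrC (_ : - m%:Z = - (m%:Z + 1) + 1); last by ring.
    by apply: H; lia.
  by apply: IH => s hs; apply: H; lia.
Qed.

(** Here [eta] is a point on the [j]-th leg: its other coordinates are already final or still zero,
    and each factor is bounded separately. *)
Lemma mfalling_bound n (eta theta : 'rV[int]_n) (j : 'I_n) (beta : 'X_{1..n}) :
  (forall i, i != j -> eta 0 i = theta 0 i \/ eta 0 i = 0) ->
  0 <= eta 0 j < theta 0 j \/ theta 0 j <= eta 0 j < 0 ->
  `|theta 0 j * mfalling eta beta| <= `|mfalling theta (beta + U_(j))%MM|.
Proof.
move=> he hj; rewrite /mfalling (bigD1 j) //= [X in _ <= `|X|](bigD1 j) //=.
rewrite mulrA normrM [leRHS]normrM mnmDE mnm1E eqxx addn1.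
apply: ler_pM => //; first exact: falling_bound.
rewrite !normr_prod; apply: ler_prod => i ij; rewrite normr_ge0 /=.
rewrite mnmDE mnm1E eq_sym (negPf ij) addn0.
by case: (he i ij) => ->; [exact: lexx | exact: falling0_bound].
Qed.

(** Stated over any [numFieldType], so that it applies to [R[i]] with its own norm and a bound [B]
    taken in the same field. *)
Lemma taylor_rem_le (F : numFieldType) n M (p : 'rV[int]_n -> F)
    (xi theta : 'rV[int]_n) (B : F) : 0 <= B ->
  (forall alpha, mdeg alpha = M -> forall nu, Qbox theta nu ->
     `|(mfalling theta alpha)%:~R * mfdiff alpha p (xi + nu)| <= B) ->
  `|taylor_rem M p xi theta| <= n%:R ^+ M * B.
Proof.
elim: M p theta B => [|M IH] p theta B B0 H.
  (* With an empty Taylor sum the remainder is [p (xi + theta)], which [H] bounds at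
     [nu = theta]. *)
  rewrite expr0 mul1r /taylor_rem big_pred0 ?subr0 => [|a]; last first.
    by have := bmdeg a.
  have := H 0%MM mdeg0 theta (fun=> lexx _).
  rewrite /mfalling big1 ?mul1r ?mfdiff0 // => i _.
  by rewrite mnm0E /falling big_ord0.
(* The corners of the path: [eta k] agrees with [theta] in the first [k] coordinates. Each leg costs
   at most [n ^ M * B], and there are [n] legs. *)
pose eta k : 'rV[int]_n := \row_i if (i < k)%N then theta 0 i else 0.
have main k : (k <= n)%N ->
    `|taylor_rem M.+1 p xi (eta k)| <= k%:R * (n%:R ^+ M * B).
  elim: k => [|k IHk] kn.
    rewrite (_ : eta 0%N = 0) ?taylor_rem0 ?normr0 ?mul0r //.
    by apply/rowP => i; rewrite !mxE.
  pose j := Ordinal kn.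
  pose f s := taylor_rem M.+1 p xi (eta k + s *: delta_mx 0 j).
  have f0 : f 0 = taylor_rem M.+1 p xi (eta k) by rewrite /f scale0r addr0.
  have ft : f (theta 0 j) = taylor_rem M.+1 p xi (eta k.+1).
    congr taylor_rem; apply/rowP => i; rewrite !mxE eqxx /=.
    have [->|ij] := eqVneq i j; first by rewrite /= ltnn ltnSn mulr1 add0r.
    rewrite mulr0 addr0 ltnS (leq_eqVlt i).
    by have /negPf -> : (i : nat) != k by exact: ij.
  rewrite -ft -(subrK (f 0) (f (theta 0 j))) addrC -natr1 mulrDl mul1r.
  apply: le_trans (ler_normD _ _) (lerD _ _).
    by rewrite f0; apply/IHk/ltnW.
  (* A leg of length zero contributes nothing; excluding it permits division by [|theta_j|]. *)
  have [t0|t0] := eqVneq (theta 0 j) 0.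
    by rewrite t0 subrr normr0 mulr_ge0 // exprn_ge0.
  have tpos : 0 < `|theta 0 j|%:~R :> F by rewrite ltr0z normr_gt0.
  (* Each of the [|theta_j|] steps may cost [n ^ M * B / |theta_j|], so the induction hypothesis is
     used with the bound [B / |theta_j|]. *)
  rewrite -[leRHS](mulVKf (lt0r_neq0 tpos)).
  apply: telescope_int => s hs.
  rewrite /f scalerDl scale1r addrA taylor_rem_diff mulrCA.
  have es : (eta k + s *: delta_mx 0 j) 0 j = s.
    by rewrite !mxE !eqxx /= ltnn add0r mulr1.
  have ei i : i != j -> (eta k + s *: delta_mx 0 j) 0 i = theta 0 i
      \/ (eta k + s *: delta_mx 0 j) 0 i = 0.
    move=> ij; rewrite !mxE (negPf ij) andbF mulr0 addr0.
    by case: ifP; [left | right].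
  apply: IH; first by rewrite mulr_ge0 // invr_ge0 ltW.
  move=> beta hb nu hnu.
  rewrite ler_pdivlMl // -mfdiffU -mfdiffD.
  (* Points of the path stay in the box of [theta], so their own boxes do too. *)
  have nuQ : Qbox theta nu.
    move=> i; apply: le_trans (hnu i) _.
    have [->|ij] := eqVneq i j; first by rewrite es; lia.
    by case: (ei i ij) => ->; rewrite ?normr0.
  have db : mdeg (beta + U_(j))%MM = M.+1 by rewrite mdegD mdeg1 hb addn1.
  apply: le_trans (H _ db nu nuQ).
  rewrite !normrM mulrA ler_wpM2r //.
  rewrite -!intr_norm -rmorphM /= ler_int -normrM.
  by apply: mfalling_bound => //; rewrite es.
have := main n (leqnn n).
rewrite (_ : eta n = theta) ?mulrA -?exprS //.
by apply/rowP => i; rewrite mxE ltn_ord.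
Qed.

(** * Passage to the maximum and conclusion *)

Lemma cabs_le_max_taylor (R : realType) n M (p : 'rV[int]_n -> R[i])
    (omega alpha : 'X_{1..n}) (xi theta nu : 'rV[int]_n) :
  mdeg alpha = M -> Qbox theta nu ->
  cabs ((mfalling theta alpha)%:~R * mfdiff (alpha + omega)%MM p (xi + nu))
    <= max_taylor M p omega xi theta.
Proof.
move=> da nuQ; have lt : (mdeg alpha < M.+1)%N by rewrite da.
apply: (bigmax_sup (BMultinom lt)); first by rewrite da.
apply: (@le_bigmax_seq _ _ _ _ 0 nu xpredT (fun nu => cabs _)) => //.
by rewrite in_fset_set ?inE //; exact: finite_Qbox.
Qed.

Lemma max_taylor_ge0 (R : realType) n M (p : 'rV[int]_n -> R[i])
    (omega : 'X_{1..n}) (xi theta : 'rV[int]_n) :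
  0 <= max_taylor M p omega xi theta.
Proof. exact: bigmax_ge_id. Qed.

Unset Implicit Arguments.
Set Strict Implicit.

Theorem theorem3p4 (R : realType) (n M : nat) (hn : (0 < n)%N) :
  exists CM : R, forall p : 'rV[int]_n -> R[i],
    exists r : 'rV[int]_n -> 'rV[int]_n -> R[i],
      (forall xi theta : 'rV[int]_n,
         p (xi + theta) =
           \sum_(alpha : 'X_{1..n < M})
              (mfactorial alpha)%:R^-1 * (mfalling theta alpha)%:~R
              * mfdiff alpha p xi
           + r xi theta) /\
      (forall (omega : 'X_{1..n}) (xi theta : 'rV[int]_n),
         cabs (mfdiff omega (fun x => r x theta) xi)
           <= CM * max_taylor M p omega xi theta).
Proof.
(* The expansion forces the choice of [r]; the constant counts [n] legs at each of the [M] levels of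
   the induction. *)
exists (n%:R ^+ M) => p; exists (taylor_rem M p); split=> [xi theta|].
  by rewrite [RHS]addrC subrK.
(* [lecR] moves the inequality from [R] to [R[i]], where the norm is [cabs] viewed as a complex
   number. *)
move=> omega xi theta; rewrite mfdiff_taylor_rem -lecR.
rewrite rmorphM rmorphXn rmorph_nat.
apply: taylor_rem_le => [|alpha da nu nuQ].
  by rewrite ler0c max_taylor_ge0.
by rewrite -mfdiffD lecR cabs_le_max_taylor.
Qed.
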